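(* Let $n = pq$, where $p$ and $q$ are distinct odd primes. Then $h(n) = (n-1)/2$.
   Context: $A_n$ is the alternating group of degree $n$, acting on $\mathbb{Z}_n = \mathbb{Z}/n\mathbb{Z} = \{0,1,\ldots,n-1\}$. Permutations act on the right (the image of $x$ under $\pi$ is $x^\pi$) and are composed from left to right. For $n$ odd, let $c = (0,1,\ldots,n-1) \in A_n$, i.e. $x^c = x+1$. For $\pi \in A_n$, $[\pi] = \langle c\rangle \pi$ is the coset of $\langle c \rangle$ containing $\pi$; its elements are the permutations $c^j\pi$ (first $c^j$, then $\pi$). Define $h(\pi)$ to be the minimum number of 3-cycles in an expression of $\pi$ as a product of (not necessarily disjoint) 3-cycles in $A_n$, with $h(\mathrm{id}) = 0$. Define $h([\pi]) = \min_{\sigma \in [\pi]} h(\sigma) = \min_{0 \le j \le n-1} h(c^j\pi)$ and $h(n) = \max_{\pi \in A_n} h([\pi])$. *)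

(* Defs.v *)
From mathcomp Require Import all_boot all_fingroup all_solvable.

Set Implicit Arguments.
Unset Strict Implicit.
Unset Printing Implicit Defensive.

Section ThreeCycles.
Variable T : finType.
Implicit Type s : {perm T}.

Definition three_cycle s : bool :=
  [exists x, exists y, exists z,
    [&& uniq [:: x; y; z], s x == y, s y == z, s z == x
      & perm_on [set x; y; z] s]].

Definition prod_three_cycles (k : nat) s : bool :=
  [exists t : k.-tuple {perm T},
    all three_cycle t && (s == (\prod_(u <- t) u)%g)].

Lemma prod_three_cycles_cat k l s1 s2 :
  prod_three_cycles k s1 -> prod_three_cycles l s2 ->
  prod_three_cycles (k + l) (s1 * s2)%g.
Proof.
move=> /existsP[t1 /andP[a1 /eqP->]] /existsP[t2 /andP[a2 /eqP->]].
by apply/existsP; exists (cat_tuple t1 t2); rewrite all_cat a1 a2 big_cat /=.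
Qed.

Lemma prod_three_cycles_id : prod_three_cycles 0 1%g.
Proof. by apply/existsP; exists [tuple]; rewrite /= big_nil. Qed.

Lemma prod_three_cycles_tperm2 (a b d : T) : a != b -> b != d ->
  exists k, prod_three_cycles k (tperm a b * tperm b d)%g.
Proof.
move=> ab bd; have [<-|ad] := eqVneq a d.
  by exists 0; rewrite (tpermC b a) tperm2 prod_three_cycles_id.
exists 1; apply/existsP; exists [tuple (tperm a b * tperm b d)%g].
rewrite /= big_seq1 eqxx !andbT.
apply/existsP; exists a; apply/existsP; exists d; apply/existsP; exists b.
rewrite /= !inE negb_or ad ab eq_sym bd /= !permM !tpermL !tpermR.
rewrite (tpermD (z := d)) // tpermR (tpermD (z := a)) 1?eq_sym // !eqxx /=.
apply/subsetP=> x; rewrite !inE permM; apply: contraR.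
rewrite !negb_or => /andP[/andP[xa xd] xb].
by rewrite !tpermD // eq_sym.
Qed.

Lemma prod_three_cycles_tperm (a b c d : T) : a != b -> c != d ->
  exists k, prod_three_cycles k (tperm a b * tperm c d)%g.
Proof.
move=> ab; have [<-|bc cd] := eqVneq b c.
  exact: prod_three_cycles_tperm2.
have [k hk] := prod_three_cycles_tperm2 ab bc.
have [l hl] := prod_three_cycles_tperm2 bc cd.
exists (k + l); have := prod_three_cycles_cat hk hl.
by rewrite mulgA -(mulgA (tperm a b)) tperm2 mulg1.
Qed.

Lemma prod_three_cycles_ex s :
  exists k, (s \in ('Alt_T)%g) ==> prod_three_cycles k s.
Proof.
case: (boolP (s \in ('Alt_T)%g)) => [|_]; last by exists 0.
rewrite Alt_even => s_even; case: (prod_tpermP s) s_even => ts -> {s}.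
have [n] := ubnP (size ts); elim: n ts => // n IHn [|[a b] [|[c d] ts]] /=.
- by move=> *; exists 0; rewrite big_nil prod_three_cycles_id.
- by rewrite big_seq1 odd_tperm /dpair /= => _ /andP[->].
rewrite !ltnS => size_ts /and3P[ab cd dts].
rewrite !big_cons mulgA !odd_permM !odd_tperm ab cd /= => ev.
have [k hk] := prod_three_cycles_tperm ab cd.
have [l hl] := IHn ts (ltnW size_ts) dts ev.
by exists (k + l); apply: prod_three_cycles_cat.
Qed.

(* Outside the alternating group the value is 0, by convention. *)
Definition h_perm s : nat := ex_minn (prod_three_cycles_ex s).

End ThreeCycles.

(* MathComp composes permutations from left to right: (s * t) x = t (s x). *)
Definition shift_cycle (n : nat) : {perm 'I_n} := perm (@ordS_inj n).

(* As pi belongs to its own coset, starting the minimum from h_perm pi does not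
   affect it. For n odd the coset lies in the alternating group, so that the
   conventional value of h_perm on odd permutations plays no role. *)
Definition h_coset (n : nat) (pi : {perm 'I_n}) : nat :=
  \big[minn/h_perm pi]_(s in (<[shift_cycle n]> :* pi)%g) h_perm s.

Definition h_max (n : nat) : nat := \max_(pi in ('Alt_('I_n))%g) h_coset pi.

(* Main.v *)
(* For an even permutation s of n points, h(s) = (n - o(s)) / 2 where o(s) is
   the number of cycles of odd length: a 3-cycle factor changes o by at most 2.
   As n is odd, o(s) >= 1, which gives the upper bound. For the lower bound,
   choose a that is a primitive root both modulo p and modulo q, and let pi be
   the multiplication by a, an even permutation. Every element of its coset is
   an affine map of slope a; since a ^ m - 1 is a unit modulo n for odd m, such
   a map has a single cycle of odd length. *)
Require Import Defs.
From mathcomp Require Import all_boot all_fingroup all_solvable.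
From mathcomp Require Import ssralg finalg zmodp.

Set Implicit Arguments.
Unset Strict Implicit.
Unset Printing Implicit Defensive.

(** * Odd orbits and the lower bound on the number of 3-cycles *)

Definition odd_porbits (T : finType) (s : {perm T}) : {set {set T}} :=
  [set C in porbits s | odd #|C|].

Lemma porbits_partition (T : finType) (s : {perm T}) :
  partition (porbits s) [set: T].
Proof.
have -> : porbits s = orbit 'P <[s]> @: [set: T].
  apply/setP=> C; apply/imsetP/imsetP => -[x _ ->]; exists x => //.
    by rewrite porbitE.
  by rewrite porbitE.
by apply: orbit_partition; apply/actsP=> a _ x; rewrite !inE.
Qed.

(** The orbit lengths add up to [#|T|], and modulo 2 only the odd ones count. *)
Lemma odd_card_odd_porbits (T : finType) (s : {perm T}) :
  odd #|odd_porbits s| = odd #|T|.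
Proof.
rewrite -cardsT (card_partition (porbits_partition s))
  -sum1dep_card big_mkcondr /=.
rewrite !(big_morph odd oddD (erefl _)).
by apply: eq_bigr => C _; case: (odd #|C|).
Qed.

Lemma porbit_eq_on (T : finType) (s t : {perm T}) (x : T) :
  {in porbit s x, s =1 t} -> porbit s x = porbit t x.
Proof.
move=> st; have E i : (s ^+ i)%g x = (t ^+ i)%g x.
  elim: i => [|i IH]; first by rewrite !expg0.
  by rewrite !expgSr !permM -IH st // mem_porbit.
by apply/setP=> y; apply/porbitP/porbitP => -[i ->]; exists i; rewrite E.
Qed.

(* At most three odd orbits meet the support of [t]; the bound 3 improves to 2
   because the number of odd orbits has the parity of [#|T|]. *)
Lemma leq_odd_porbits_three_cycleM (T : finType) (s t : {perm T}) :
  three_cycle t -> #|odd_porbits s| <= #|odd_porbits (t * s)| + 2.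
Proof.
move=> /existsP[x /existsP[y /existsP[z /and5P[_ _ _ _ /subsetP tD]]]].
have tE w : w \notin [set x; y; z] -> t w = w.
  by move=> wD; apply/eqP; apply: contraNT wD => /tD.
have le3 : #|odd_porbits s| <= #|odd_porbits (t * s)| + 3.
  have sub : odd_porbits s \subset
      odd_porbits (t * s) :|: [set porbit s w | w in [set x; y; z]].
    apply/subsetP=> C; rewrite !inE => /andP[/imsetP[w _ ->{C}] oddC].
    have [/existsP[v /andP[vD vC]]|] :=
        boolP [exists v in [set x; y; z], v \in porbit s w].
      apply/orP; right; apply/imsetP; exists v => //.
      by apply/esym/eqP; rewrite eq_porbit_mem.
    rewrite negb_exists_in => /forall_inP dis.
    have C_eq : porbit s w = porbit (t * s) w.
      apply: porbit_eq_on => v vC; rewrite permM tE //.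
      by apply: contraL vC => /dis.
    by rewrite oddC C_eq imset_f.
  apply: leq_trans (subset_leq_card sub) _.
  apply: leq_trans (leq_card_setU _ _) _.
  rewrite leq_add2l; apply: leq_trans (leq_imset_card _ _) _.
  by rewrite (leq_trans (leq_card_setU _ _)) // cards1 cards2; case: eqP.
rewrite leqNgt; apply/negP => lt2.
have E : #|odd_porbits s| = #|odd_porbits (t * s)| + 3.
  by apply/eqP; rewrite eqn_leq le3 addnS.
have := odd_card_odd_porbits s.
by rewrite E oddD !odd_card_odd_porbits; case: odd.
Qed.

(** The identity has [#|T|] odd orbits, all singletons, and each 3-cycle factor changes the count by
    at most two. *)
Lemma prod_three_cycles_odd_porbits (T : finType) (s : {perm T}) (k : nat) :
  prod_three_cycles k s -> #|T| <= #|odd_porbits s| + k.*2.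
Proof.
case/existsP=> -[t /= /eqP <-] /andP[+ /eqP->].
elim: t => [_|u t IH /= /andP[u3 /IH le_t]].
  rewrite big_nil addn0 -(card_imset _ (@set1_inj T)) subset_leq_card //.
  apply/subsetP=> _ /imsetP[x _ ->]; rewrite inE cards1 andbT.
  apply/imsetP; exists x => //; apply/setP=> y; rewrite inE.
  apply/eqP/porbitP => [->|[i ->]]; first by exists 0; rewrite perm1.
  by rewrite expg1n perm1.
rewrite big_cons; apply: leq_trans le_t _.
rewrite doubleS -addn2 addnA addnAC leq_add2r.
exact: leq_odd_porbits_three_cycleM.
Qed.

(** * Few 3-cycles suffice: the upper bound *)

Lemma prod_three_cycles_common (T : finType) (a b d : T) :
  a != b -> b != d -> a != d -> prod_three_cycles 1 (tperm a b * tperm b d)%g.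
Proof.
move=> ab bd ad; apply/existsP; exists [tuple (tperm a b * tperm b d)%g].
rewrite /= big_seq1 eqxx !andbT.
apply/existsP; exists a; apply/existsP; exists d; apply/existsP; exists b.
rewrite /= !inE negb_or ad ab eq_sym bd /= !permM !tpermL !tpermR.
rewrite (tpermD (z := d)) // tpermR (tpermD (z := a)) 1?eq_sym // !eqxx /=.
apply/subsetP=> x; rewrite !inE permM; apply: contraR.
rewrite !negb_or => /andP[/andP[xa xd] xb].
by rewrite !tpermD // eq_sym.
Qed.

(** Inserting [tperm b c] twice in the middle leaves two pairs of transpositions, each pair sharing
    one point. *)
Lemma prod_three_cycles_disjoint (T : finType) (a b c d : T) :
  uniq [:: a; b; c; d] -> prod_three_cycles 2 (tperm a b * tperm c d)%g.
Proof.
rewrite /= !inE !negb_or andbT => /and3P[/and3P[ab ac ad] /andP[bc bd] cd].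
have := prod_three_cycles_cat (prod_three_cycles_common ab bc ac)
  (prod_three_cycles_common bc cd bd).
by rewrite mulgA -(mulgA (tperm a b)) tperm2 mulg1.
Qed.

Definition moved (T : finType) (s : {perm T}) : {set T} := [set x | s x != x].

(** The transposition brings [s x] back to [x], and a fixed point of [s] is neither [x] nor [s x]
    unless [x] itself is fixed. *)
Lemma moved_mul_tperm (T : finType) (s : {perm T}) (x : T) :
  moved (s * tperm x (s x)) \subset moved s :\ x.
Proof.
apply/subsetP=> u; rewrite !inE permM => su.
have ux : u != x by apply: contraNneq su => ->; rewrite tpermR.
rewrite ux /=; apply: contraNneq su => su.
rewrite su tpermD //; first by rewrite eq_sym.
by apply: contraNneq ux => e; rewrite -(inj_eq (@perm_inj _ s)) e su.
Qed.

(** Induction on the number of moved points: each 3-cycle split off pays for two points that become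
    fixed. *)
Lemma even_prod_three_cycles (T : finType) (s : {perm T}) :
  ~~ odd_perm s -> exists2 k, k.*2 <= #|moved s| & prod_three_cycles k s.
Proof.
have [m] := ubnP #|moved s|; elim: m s => // m IH s; rewrite ltnS => le_m ev.
have [->|s1] := eqVneq s 1%g; first by exists 0; rewrite //
  prod_three_cycles_id.
have nt (t : {perm T}) : t != 1%g -> exists x, t x != x.
  move=> t1; apply/existsP; apply: contraR t1;
    rewrite negb_exists => /forallP h.
  by apply/eqP/permP => x; rewrite perm1; apply/eqP; rewrite -[_ == _]negbK h.
have mulK (t : {perm T}) a b c d :
  t = (s * tperm a b * tperm c d)%g -> s = (t * (tperm c d * tperm a b))%g.
  move=> ->; rewrite !mulgA -(mulgA _ (tperm c d) (tperm c d)) tperm2 mulg1.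
  by rewrite -mulgA tperm2 mulg1.
(* If [x] lies on a cycle of length at least 3, one 3-cycle on [x], [s x], [s (s x)] makes [x] and
   [s x] fixed. Otherwise [s] is an involution. *)
have [/existsP[x ssx]|invol] := boolP [exists x, s (s x) \notin [set x; s x]].
  move: ssx; rewrite !inE negb_or => /andP[ssx sy].
  pose y := s x; pose z := s y.
  have xy : x != y by rewrite eq_sym; apply: contraNneq sy; rewrite /y => e;
    rewrite !e.
  pose s' := (s * tperm x y)%g; have s'y : s' y = z.
    by rewrite permM tpermD // eq_sym.
  pose t := (s' * tperm y z)%g.
  have sub : moved t \subset (moved s :\ x) :\ y.
    have := moved_mul_tperm s' y; rewrite s'y => /subset_trans; apply.
    exact/setSD/moved_mul_tperm.
  have card_t : #|moved t| + 2 <= #|moved s|.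
    have xin : x \in moved s by rewrite inE eq_sym.
    have yin : y \in moved s :\ x by rewrite !inE eq_sym xy.
    rewrite (cardsD1 x (moved s)) (cardsD1 y (_ :\ x)) xin yin.
    by rewrite addnA addnC leq_add2l subset_leq_card.
  have [||k le_k kt] := IH t.
  - by apply: leq_trans le_m; rewrite (leq_trans _ card_t) // addn2.
  - by rewrite !odd_permM !odd_tperm (negPf ev) xy eq_sym sy.
  exists k.+1; first by rewrite doubleS -addn2 (leq_trans _ card_t) //
    leq_add2r.
  rewrite (mulK t x y y z) // -addn1; apply: prod_three_cycles_cat => //.
  by rewrite (tpermC y) (tpermC x); apply: prod_three_cycles_common;
    rewrite // eq_sym.
have ss x : s x != x -> s (s x) = x.
  move: invol; rewrite negb_exists => /forallP/(_ x); rewrite negbK !inE.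
  by case/orP=> /eqP // e; move/perm_inj: (e) => ->; rewrite eqxx.
have [x sx] := nt _ s1; pose y := s x.
pose s' := (s * tperm x y)%g.
(* An even [s] is not a single transposition, so a second one, [tperm u (s u)], is disjoint from the
   first. Removing both costs two 3-cycles and fixes four points. *)
have [|u s'u] := nt s'.
  apply: contraNneq ev => e; rewrite -[s](mulgK (tperm x y)) -/s' e.
  by rewrite odd_permM odd_perm1 odd_permV odd_tperm eq_sym sx.
have : u \in moved s :\ x by apply: (subsetP (moved_mul_tperm s x));
  rewrite inE.
rewrite !inE => /andP[ux su].
have uy : u != y.
  by apply: contraNneq s'u => ->; rewrite permM ss // tpermL.
have [xu yu] : x != u /\ y != u by rewrite !(eq_sym _ u).
have vx : s u != x by apply: contraNneq uy => e; rewrite /y -e ss.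
have vy : s u != y by rewrite (inj_eq perm_inj).
have s'uE : s' u = s u by rewrite permM tpermD 1?eq_sym.
pose v := s u; pose t := (s' * tperm u v)%g.
have t_v : v \notin moved t.
  by rewrite inE negbK !permM ss // (tpermD xu yu) tpermL.
have t_y : y \notin moved t.
  by rewrite inE negbK !permM ss // tpermL tpermD.
have sub : moved t \subset moved s :\ x :\ y :\ u :\ v.
  apply/subsetP=> w wt.
  have: w \in moved s' :\ u.
    by apply: (subsetP (moved_mul_tperm s' u)); rewrite s'uE.
  rewrite in_setD1 => /andP[wu /(subsetP (moved_mul_tperm s x))].
  rewrite !in_setD1 => /andP[wx ws].
  by rewrite wx ws wu !andbT; apply/andP; split; apply: contraTneq wt => ->.
have uniq4 : uniq [:: u; v; x; y].
  by rewrite /= !inE !negb_or eq_sym su ux uy vx vy eq_sym sx.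
have card_t : #|moved t| + 4 <= #|moved s|.
  rewrite (cardsD1 x (moved s)) (cardsD1 y (_ :\ x)).
  rewrite (cardsD1 u (_ :\ y)) (cardsD1 v (_ :\ u)).
  rewrite !inE sx su ux uy vx vy /v !(inj_eq perm_inj) su sx /=.
  by rewrite !addnA addnC leq_add2l subset_leq_card.
have [||k le_k kt] := IH t.
- apply: leq_trans le_m; rewrite (leq_trans _ card_t) //.
  by rewrite addn4 !ltnS -addn3 leq_addr.
- by rewrite !odd_permM !odd_tperm (negPf ev) !(eq_sym _ (s _)) sx su.
exists (k + 2); first by rewrite doubleD (leq_trans _ card_t) // leq_add2r.
rewrite (mulK t x y u v) //.
exact: prod_three_cycles_cat kt (prod_three_cycles_disjoint uniq4).
Qed.

Lemma h_perm_leq (T : finType) (s : {perm T}) : h_perm s <= #|T|./2.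
Proof.
rewrite /h_perm; case: ex_minnP => k _ min_k.
have [ev|od] := boolP (~~ odd_perm s); last first.
  (* For odd [s] the implication defining [h_perm] is vacuous, so its value is 0. *)
  by rewrite (leq_trans (min_k 0 _)) // Alt_even (negPf od).
have [l le_l ls] := even_prod_three_cycles ev.
apply: leq_trans (min_k l _) _; first by rewrite ls implybT.
by rewrite -(doubleK l) half_leq // (leq_trans le_l) // max_card.
Qed.

Lemma leq_h_perm (T : finType) (s : {perm T}) (m : nat) : ~~ odd_perm s ->
  #|odd_porbits s| + m.*2 <= #|T| -> m <= h_perm s.
Proof.
rewrite /h_perm -Alt_even => ev le_m; case: ex_minnP => k.
rewrite ev => /prod_three_cycles_odd_porbits/(leq_trans le_m) + _.
by rewrite leq_add2l leq_double.
Qed.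

(** * Primitive roots and the sign of multiplication maps *)

Lemma primitive_root_exists (p : nat) : prime p ->
  exists g, forall k, (g ^ k == 1 %[mod p]) = (p.-1 %| k).
Proof.
move=> p_pr; have p_gt1 := prime_gt1 p_pr.
(* The root is a generator of the cyclic group of units modulo [p], whose order is [totient p]. *)
have [u gen_u] := cyclicP (units_Zp_cyclic p_pr).
exists (nat_of_ord (FinRing.uval u)) => k.
have <- : #[u]%g = p.-1.
  by rewrite orderE -gen_u card_units_Zp ?prime_gt0 // totient_prime.
rewrite order_dvdn -(inj_eq val_inj) FinRing.val_unitX FinRing.val_unit1.
rewrite -(inj_eq val_inj) /=.
rewrite -[X in (X ^+ k)%R](natr_Zp (FinRing.uval u)) -GRing.natrX.
by rewrite val_Zp_nat //; congr (_ == _ %% _); rewrite Zp_cast.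
Qed.

Lemma mul_perm_inj (n a : nat) (n_gt0 : 0 < n) (co : coprime n a) :
  injective (fun x : 'I_n => Ordinal (ltn_pmod (a * x) n_gt0)).
Proof.
move=> x y [] /eqP.
rewrite -[_ == _]/(a * x == a * y %[mod n]);
  wlog le_xy : x y / x <= y => [wl e|].
  by case: (leqP x y) => [|/ltnW] le; [apply: wl | apply/esym/wl; rewrite //
    eq_sym].
rewrite eq_sym eqn_mod_dvd ?leq_mul // -mulnBr Gauss_dvdr // -eqn_mod_dvd //.
by rewrite !modn_small // => /eqP/val_inj.
Qed.

Definition mul_perm (n a : nat) (n_gt0 : 0 < n) (co : coprime n a) :
  {perm 'I_n} := perm (@mul_perm_inj n a n_gt0 co).

Lemma mul_permX (n a : nat) (n_gt0 : 0 < n) (co : coprime n a) (k : nat)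
  (x : 'I_n) :
  val ((mul_perm n_gt0 co ^+ k)%g x) = a ^ k * x %% n.
Proof.
elim: k => [|k IH]; first by rewrite perm1 mul1n modn_small.
by rewrite expgSr permM permE /= IH modnMmr mulnA expnS.
Qed.

(** The orbit length is the exact period of [x]; this reads orbit lengths off the fixed points of
    powers. *)
Lemma dvdn_card_porbit (T : finType) (s : {perm T}) (x : T) (k : nat) :
  (#|porbit s x| %| k) = ((s ^+ k)%g x == x).
Proof.
set c := #|porbit s x|; have c_gt0 : 0 < c by rewrite lt0n card_porbit_neq0.
have sc : (s ^+ c)%g x = x by rewrite permX iter_porbit.
have scm m : (s ^+ (m * c))%g x = x.
  by elim: m => [|m IH]; rewrite ?perm1 // mulSn expgD permM sc IH.
have -> : (s ^+ k)%g x = (s ^+ (k %% c))%g x.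
  by rewrite {1}(divn_eq k c) expgD permM scm.
rewrite /dvdn; have := ltn_pmod k c_gt0; case: (k %% c) => [|i] lt_ic.
  by rewrite perm1 !eqxx.
have := uniq_traject_porbit s x; rewrite -/c -(prednK c_gt0) /= => /andP[+ _].
move=> nx; apply/esym; move: nx; apply: contraNF => /eqP e; apply/trajectP.
exists i => /=; last by rewrite -iterSr -permX.
by rewrite -ltnS prednK.
Qed.

Lemma sum_dvdn (p q : nat) : 0 < p -> \sum_(i < p * q) (p %| i) = q.
Proof.
move=> p_gt0; rewrite -[RHS](mulKn q p_gt0) divn_count_dvd big_add1 /=.
(* The known count runs over 1 to [p * q], this one over 0 to [p * q - 1]; both end points are
   multiples of [p], so adding the missing one to each side gives the same sum. *)
apply: (@addIn 1); rewrite -(big_mkord xpredT (fun i => p %| i : nat)).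
have e0 : 1 = (p %| 0) by rewrite dvdn0.
have en : 1 = (p %| p * q) by rewrite dvdn_mulr.
by rewrite {1}en -big_nat_recr // big_nat_recl //= -e0 addnC.
Qed.

(* [porbits s] splits into [q] fixed points and [N] orbits of size [p.-1],
   and [p * q = q + p.-1 * N] forces [N = q]; so there are [2 q] orbits. *)
Lemma odd_mul_perm (n p q a : nat) (n_gt0 : 0 < n) (co : coprime n a) :
  n = p * q -> prime p -> odd p -> odd q -> coprime p q -> a = 1 %[mod q] ->
  (forall k, (a ^ k == 1 %[mod p]) = (p.-1 %| k)) ->
  odd_perm (mul_perm n_gt0 co).
Proof.
move=> n_pq; subst n; move=> p_pr p_odd q_odd co_pq a1 ap.
have p_gt2 : 2 < p by rewrite odd_prime_gt2.
have a_gt0 : 0 < a.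
  rewrite lt0n; apply: contraTneq (co) => ->; rewrite /coprime gcdn0 gtn_eqF //.
  by rewrite (leq_trans (ltnW p_gt2)) // leq_pmulr // odd_gt0.
set s := mul_perm _ _.
(* By the Chinese remainder theorem only the condition modulo [p] matters, as [a] is 1 modulo [q];
   it says that [p] divides [(a ^ k - 1) * x]. *)
have fixE (x : 'I_(p * q)) k : ((s ^+ k)%g x == x) = (p %| x) || (p.-1 %| k).
  rewrite -val_eqE /= mul_permX.
  rewrite -[X in _ == X](modn_small (ltn_ord x)) chinese_remainder //.
  have -> : a ^ k * x == x %[mod q].
    by rewrite -modnMml -modnXm a1 modnXm exp1n modnMml mul1n.
  rewrite andbT -ap -{2}[nat_of_ord x]mul1n.
  rewrite !eqn_mod_dvd ?leq_mul ?expn_gt0 ?a_gt0 //.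
  by rewrite -mulnBl Euclid_dvdM // orbC.
have cardE : forall x : 'I_(p * q), #|porbit s x| = if p %| x then 1 else p.-1.
  move=> x; case: ifP => px; apply/eqP; rewrite eqn_dvd.
    by rewrite dvd1n andbT dvdn_card_porbit fixE px.
  have px' k : (#|porbit s x| %| k) = (p.-1 %| k).
    by rewrite dvdn_card_porbit fixE px.
  by rewrite px' dvdnn -px' dvdnn.
have p1_neq1 : p.-1 != 1 by rewrite gtn_eqF // -ltnS prednK // ltnW // ltnW.
rewrite /odd_perm.
pose P1 := [set C in porbits s | #|C| == 1].
pose N := [set C in porbits s | #|C| != 1].
have cardP : #|porbits s| = #|P1| + #|N|.
  rewrite -(cardsID [set C : {set 'I_(p * q)} | #|C| == 1]).
  congr (_ + _); apply: eq_card => C; rewrite !inE //.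
  by rewrite andbC.
have eqn : p * q = #|P1| + #|N| * p.-1.
  transitivity #|[set: 'I_(p * q)]|; first by rewrite cardsT card_ord.
  rewrite (card_partition (porbits_partition s)).
  rewrite (bigID [pred C : {set 'I_(p * q)} | #|C| == 1]) /=; congr (_ + _).
    by rewrite -sum1dep_card; apply: eq_bigr => C /andP[_ /eqP].
  rewrite -sum_nat_const; apply: eq_big => C; first by rewrite !inE.
  by case/andP=> /imsetP[x _ ->]; rewrite cardE; case: ifP.
have cardP1 : #|P1| = q.
  have -> : #|P1| = #|[set x : 'I_(p * q) | p %| x]|.
    have -> : P1 = [set [set x] | x in [set x : 'I_(p * q) | p %| x]].
      apply/setP=> C; apply/idP/imsetP => [|[x]]; rewrite !inE.
        case/andP=> /imsetP[x _ ->] c1; exists x.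
          rewrite inE; move: c1; rewrite cardE; case: ifP => // _.
          by rewrite (negPf p1_neq1).
        by apply/esym/eqP; rewrite eqEcard (eqP c1) cards1 sub1set porbit_id.
      move=> px ->; rewrite cards1 andbT; apply/imsetP; exists x => //.
      by apply/eqP; rewrite eqEcard cardE px cards1 sub1set porbit_id.
    by rewrite card_imset //; apply: set1_inj.
  rewrite -sum1dep_card big_mkcond -[RHS](sum_dvdn q (prime_gt0 p_pr)).
  by apply: eq_bigr => x _; case: ifP.
have NE : #|N| = q.
  move: eqn; rewrite cardP1 -{1}(prednK (prime_gt0 p_pr)) mulSn => /addnI/eqP.
  rewrite mulnC eqn_pmul2r => [/eqP //|].
  by rewrite -ltnS prednK ?prime_gt0 ?prime_gt1.
(* The sign compares the parity of [p * q], which is odd, with that of the number of orbits, which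
   is even. *)
by rewrite cardP cardP1 NE card_ord oddM p_odd q_odd addnn odd_double.
Qed.

(** * Affine maps and the coset of the cycle *)

Lemma affine_permX (n a b : nat) (s : {perm 'I_n}) (m : nat) :
  (forall x, val (s x) = (a * x + b) %% n) ->
  exists c, forall x, val ((s ^+ m)%g x) = (a ^ m * x + c) %% n.
Proof.
move=> sE; elim: m => [|m [c IH]].
  by exists 0 => x; rewrite perm1 mul1n addn0 modn_small.
exists (a * c + b) => x.
by rewrite expgSr permM sE IH -modnDml modnMmr modnDml mulnDr mulnA
  -expnS addnA.
Qed.

(* The [m]-th power of [s], for [m] the product of the lengths of two orbits,
   fixes a point of each; their difference is then fixed by [a ^ m]. *)
Lemma affine_odd_porbits (n a b : nat) (s : {perm 'I_n}) :
  (forall x, val (s x) = (a * x + b) %% n) ->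
  (forall m z, odd m -> a ^ m * z = z %[mod n] -> n %| z) ->
  #|odd_porbits s| <= 1.
Proof.
move=> sE odd_fix; rewrite leqNgt; apply/negP => /card_gt1P[C [D []]].
rewrite !inE => /andP[/imsetP[x _ ->] ox] /andP[/imsetP[y _ ->] oy] /negP;
  apply.
apply/eqP; congr porbit.
pose m := #|porbit s x| * #|porbit s y|.
have om : odd m by rewrite oddM ox oy.
have mx : (s ^+ m)%g x = x by apply/eqP; rewrite -dvdn_card_porbit dvdn_mulr.
have my : (s ^+ m)%g y = y by apply/eqP; rewrite -dvdn_card_porbit dvdn_mull.
have [c cE] := affine_permX m sE.
move: (cE x) (cE y); rewrite mx my; clearbody m; clear - om odd_fix.
wlog le_xy : x y / x <= y => [wl ex ey|].
  by case: (leqP x y) => [|/ltnW] le; [apply: wl | apply/esym/wl].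
move=> ex ey; have : n %| y - x.
  apply: (odd_fix m) => //; apply/eqP; rewrite -(eqn_modDl x) subnKC //.
  have exm : x = a ^ m * x + c %[mod n] by rewrite -ex modn_small.
  rewrite -modnDml exm modnDml addnAC -mulnDr subnKC //.
  by rewrite -ey modn_small.
rewrite -eqn_mod_dvd // !modn_small // => /eqP e.
exact/esym/val_inj.
Qed.

Lemma shift_cycleX (n j : nat) (x : 'I_n) :
  val ((shift_cycle n ^+ j)%g x) = (x + j) %% n.
Proof.
elim: j => [|j IH]; first by rewrite perm1 addn0 modn_small.
by rewrite expgSr permM permE /= IH -addn1 modnDml addn1 addnS.
Qed.

Lemma odd_perm_expg (T : finType) (s : {perm T}) (k : nat) :
  odd_perm (s ^+ k)%g = odd k && odd_perm s.
Proof.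
elim: k => [|k IH]; first by rewrite odd_perm1.
by rewrite expgS odd_permM IH /=; case: odd; case: odd_perm.
Qed.

(** The [n]-th power is the identity, and an odd power preserves the sign. *)
Lemma shift_cycle_even (n : nat) : odd n -> ~~ odd_perm (shift_cycle n).
Proof.
move=> n_odd; have cn : (shift_cycle n ^+ n)%g = 1%g.
  by apply/permP=> x; apply/val_inj;
    rewrite shift_cycleX perm1 modnDr modn_small.
have := odd_perm_expg (shift_cycle n) n.
by rewrite cn odd_perm1 n_odd /= => <-.
Qed.

Lemma leq_h_coset (n : nat) (s : {perm 'I_n}) (m : nat) :
  (forall j, m <= h_perm (shift_cycle n ^+ j * s)%g) -> m <= h_coset s.
Proof.
move=> le_m; rewrite /h_coset; apply: (big_ind (fun k => m <= k)).
- by have := le_m 0; rewrite expg0 mul1g.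
- by move=> k l; rewrite leq_min => -> ->.
- by move=> t /rcosetP[c /cycleP[j ->] ->].
Qed.

Lemma h_coset_leq (n : nat) (s : {perm 'I_n}) : h_coset s <= h_perm s.
Proof.
by rewrite /h_coset; elim/big_rec: _ => // t k _ le_k;
  rewrite geq_min le_k orbT.
Qed.

(** The power [a ^ p.-1] is 1 modulo [p], with a positive exponent because [2 < p]. *)
Lemma coprime_primitive_root (p a : nat) :
  (forall k, (a ^ k == 1 %[mod p]) = (p.-1 %| k)) -> 2 < p -> coprime p a.
Proof.
move=> ap p_gt2; rewrite -(coprime_pexpr (k := p.-1)); last first.
  by rewrite -subn1 subn_gt0 ltnW.
by rewrite -coprime_modr (eqP (_ : _ == 1 %[mod p])) ?ap //
  coprime_modr coprimen1.
Qed.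

(** * The value for a product of two distinct odd primes *)

Unset Implicit Arguments.

Theorem theorem3p6 (n p q : nat) (p_prime : prime p) (q_prime : prime q)
  (p_odd : odd p) (q_odd : odd q) (p_neq_q : p <> q) (n_pq : n = p * q) :
  h_max n = (n - 1) %/ 2.
Proof.
have p_gt2 : 2 < p by rewrite odd_prime_gt2.
have q_gt2 : 2 < q by rewrite odd_prime_gt2.
have n_odd : odd n by rewrite n_pq oddM p_odd.
have n_gt0 : 0 < n by rewrite odd_gt0.
have co_pq : coprime p q by rewrite prime_coprime // dvdn_prime2 //; apply/eqP.
have nE : n = ((n - 1) %/ 2).*2.+1.
  by rewrite divn2 subn1 even_halfK ?prednK // -oddS prednK.
apply/eqP; rewrite eqn_leq; apply/andP; split.
  apply/bigmax_leqP => s _; apply: leq_trans (h_coset_leq s) _.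
  by apply: leq_trans (h_perm_leq s) _; rewrite card_ord {1}nE /= uphalf_double.
have [g gp] := primitive_root_exists p_prime.
have [g' gq] := primitive_root_exists q_prime.
(* The slope is split as [a' * a], each factor being a primitive root modulo one prime and 1 modulo
   the other. Multiplication by either factor is odd, so the composite [s] is even. *)
pose a := chinese p q g 1; pose a' := chinese p q 1 g'.
have ap k : (a ^ k == 1 %[mod p]) = (p.-1 %| k).
  by rewrite -modnXm chinese_modl // modnXm gp.
have aq : a = 1 %[mod q] by rewrite chinese_modr.
have a'q k : (a' ^ k == 1 %[mod q]) = (q.-1 %| k).
  by rewrite -modnXm chinese_modr // modnXm gq.
have a'p : a' = 1 %[mod p] by rewrite chinese_modl.
have co_a : coprime n a.
  rewrite n_pq coprimeMl (coprime_primitive_root ap) //=.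
  by rewrite -coprime_modr aq coprime_modr coprimen1.
have co_a' : coprime n a'.
  rewrite n_pq coprimeMl (coprime_primitive_root a'q) // andbT.
  by rewrite -coprime_modr a'p coprime_modr coprimen1.
pose s := (mul_perm n_gt0 co_a * mul_perm n_gt0 co_a')%g.
have ev_s : ~~ odd_perm s.
  rewrite odd_permM (odd_mul_perm _ _ n_pq) // (@odd_mul_perm n q p) //.
    by rewrite n_pq mulnC.
  by rewrite coprime_sym.
rewrite /h_max; apply: leq_trans (leq_bigmax_cond s _);
  last by rewrite Alt_even.
apply: leq_h_coset => j; apply: leq_h_perm.
  by rewrite
    odd_permM odd_perm_expg (negPf (shift_cycle_even n_odd)) andbF (negPf ev_s).
rewrite card_ord; apply: (@leq_trans (1 + ((n - 1) %/ 2).*2)); last first.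
  by rewrite add1n -nE.
rewrite leq_add2r.
(* The shift acts first, so the coset element sends [x] to [a' * a * (x + j)]. *)
apply: (@affine_odd_porbits n (a' * a) (a' * a * j)) => [x|m z om].
  rewrite permM permM permE /= permE /= shift_cycleX modnMmr.
  by rewrite mulnA -modnMmr modn_mod modnMmr mulnDr.
have even_p1 : ~~ odd p.-1 by rewrite -oddS prednK // ltnW // ltnW.
have even_q1 : ~~ odd q.-1 by rewrite -oddS prednK // ltnW // ltnW.
have not_dvd r : ~~ odd r -> (r %| m) = false.
  by move=> r_even; apply: contraTF om => /dvdn_odd/contra; apply.
(* Here [b] is the factor, [a] or [a'], to which the slope reduces modulo [r]. As [m] is odd and
   [r.-1] even, [b ^ m] is not 1 modulo [r], so [r] divides [z]. *)
have dvd_z r b : prime r -> r %| n -> ~~ odd r.-1 ->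
    (forall k, (b ^ k == 1 %[mod r]) = (r.-1 %| k)) ->
    a' * a = b %[mod r] -> (a' * a) ^ m * z = z %[mod n] -> r %| z.
  move=> r_pr r_n r_ev br ab /(congr1 (modn^~ r)); rewrite !modn_dvdm //
    => /eqP.
  rewrite -modnMml -modnXm ab modnXm modnMml.
  (* The case [b ^ m = 0] is separated because the truncated difference [b ^ m - 1] is meaningful
     only for a positive power. *)
  have [|b_gt0] := posnP (b ^ m).
    by move=> ->; rewrite mul0n mod0n eq_sym.
  rewrite -{2}[z]mul1n eqn_mod_dvd ?leq_mul // -mulnBl Euclid_dvdM //.
  by rewrite -eqn_mod_dvd // br not_dvd.
move=> e; rewrite n_pq Gauss_dvd //; apply/andP; split.
  apply: (dvd_z p a) => //; first by rewrite n_pq dvdn_mulr.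
  by rewrite -modnMml a'p modnMml mul1n.
apply: (dvd_z q a') => //; first by rewrite n_pq dvdn_mull.
by rewrite -modnMmr aq modnMmr muln1.
Qed.
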